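(* Let $A$ be an $\ell$-controllable complete group system with generator group $(\mathcal{U},\circ)$. Then $(\mathcal{U},\circ)$ contains a unique $(\ell+1)$-depth elementary system $\mathcal{E}_A$ with elementary set $\mathcal{U}$ and elementary list $\{(\nabla_{0,k}^t(\mathcal{U}),\circledcirc_{0,k}^t):0\le k\le\ell,\ t\in\mathbf{Z}\}$; that is, $\mathcal{U}$ together with the upper elementary groups $(\nabla_{0,k}^t(\mathcal{U}),\circledcirc_{0,k}^t)$ of $(\mathcal{U},\circ)$ satisfies the definition of an $(\ell+1)$-depth elementary system (including the homomorphism condition), and it is uniquely determined by $(\mathcal{U},\circ)$.
   Context: Let $(A^t)_{t\in\mathbf{Z}}$ be finite groups. A group system $A$ is a set of sequences $\mathbf{a}=(a^t)_{t\in\mathbf{Z}}$, $a^t\in A^t$, forming a group under componentwise operation, such that every element of $A^t$ occurs as a time-$t$ component, for each $t$. $\chi^t:A\to A^t$ is $\mathbf{a}\mapsto a^t$. $A$ is $\ell$-controllable ($\ell>0$) if for every $t\in\mathbf{Z}$ and all $\dot{\mathbf{a}},\ddot{\mathbf{a}}\in A$ there is $\mathbf{a}\in A$ agreeing with $\dot{\mathbf{a}}$ at all times $<t$ and with $\ddot{\mathbf{a}}$ at all times $\ge t+\ell$. $A$ is complete if every sequence in $\prod_t A^t$ whose restriction to each finite interval is the restriction of some element of $A$ belongs to $A$. $A^{[m,n]}$ is the set of sequences in $A$ that are the identity outside $[m,n]$. $X^t$ (resp. $Y^t$) is the normal subgroup of sequences in $A$ that are the identity at all times $<t$ (resp. $>t$).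 Basis: for $t\in\mathbf{Z}$, $0\le k\le\ell$ put $\Lambda^{[t,t+k]}=X^{t+1}(X^t\cap Y^{t+k})/X^{t+1}(X^t\cap Y^{t+k-1})$. A basis is a choice, for each $(k,t)$, of a transversal $[\Lambda^{[t,t+k]}]$ whose elements (generators $\mathbf{g}^{[t,t+k]}$) lie in $A^{[t,t+k]}$ and in which the trivial coset is represented by the identity sequence. $\mathcal{R}=\prod_{t\in\mathbf{Z}}\prod_{0\le k\le\ell}[\Lambda^{[t,t+k]}]$. The map $\alpha:\mathcal{R}\to A$ sends $\mathbf{r}=(\mathbf{g}^{[t,t+k]})_{k,t}$ to $\prod_{i=+\infty}^{-\infty}\prod_{m=0}^{\ell}\mathbf{g}^{[i,i+m]}$, i.e. the sequence with time-$t$ component $\prod_{j=0}^{\ell}\bigl(\prod_{k=j}^{\ell}\chi^t(\mathbf{g}^{[t-j,t-j+k]})\bigr)$ (factors written left to right in increasing $j$, and increasing $k$ for each $j$); $\alpha$ is a bijection. The operation $*$ on $\mathcal{R}$ is $\dot{\mathbf{r}}*\ddot{\mathbf{r}}=\alpha^{-1}(\alpha(\dot{\mathbf{r}})\alpha(\ddot{\mathbf{r}}))$. For each $(k,t)$ let $G_k^t$ be a set of labels with a fixed bijection $[\Lambda^{[t,t+k]}]\to G_k^t$, $\mathbf{g}^{[t,t+k]}\mapsto g_k^t$. $\mathcal{U}=\prod_{t\in\mathbf{Z}}\prod_{0\le k\le\ell}G_k^t$, and $\beta:\mathcal{R}\to\mathcal{U}$ replaces each generator by its label. The operation $\circ$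 on $\mathcal{U}$ is $\beta(\dot{\mathbf{r}})\circ\beta(\ddot{\mathbf{r}})=\beta(\dot{\mathbf{r}}*\ddot{\mathbf{r}})$; $(\mathcal{U},\circ)$ is the generator group. Upper triangles: for $t\in\mathbf{Z}$, $0\le k\le\ell$ let $T_k^t=\{(m,t-j):0\le j\le\ell-k,\ k+j\le m\le\ell\}$. For an element $\mathbf{w}=(w_m^s)_{0\le m\le\ell,s\in\mathbf{Z}}$ of a double Cartesian product $\mathcal{W}=\prod_{s\in\mathbf{Z}}\prod_{0\le m\le\ell}W_m^s$, $\nabla_{0,k}^t(\mathbf{w})=(w_m^s)_{(m,s)\in T_k^t}$, and $\nabla_{0,k}^t(\mathcal{W})=\{\nabla_{0,k}^t(\mathbf{w}):\mathbf{w}\in\mathcal{W}\}$. The upper elementary group $(\nabla_{0,k}^t(\mathcal{U}),\circledcirc_{0,k}^t)$ has the (well-defined) operation $\nabla_{0,k}^t(\dot{\mathbf{u}})\circledcirc_{0,k}^t\nabla_{0,k}^t(\ddot{\mathbf{u}})=\nabla_{0,k}^t(\dot{\mathbf{u}}\circ\ddot{\mathbf{u}})$. An $(\ell+1)$-depth elementary system consists of an elementary set $\mathcal{V}=\prod_{t\in\mathbf{Z}}\prod_{0\le k\le\ell}V_k^t$ ($V_k^t$ arbitrary sets), an elementary list of groups $(\nabla_{0,k}^t(\mathcal{V}),\odot_{0,k}^t)$, one for each $0\le k\le\ell$, $t\in\mathbf{Z}$, satisfying the homomorphism condition: for each $0\le k<\ell$ and $t\in\mathbf{Z}$, the projections $\nabla_{0,k}^t(\mathbf{v})\mapsto\nabla_{0,k+1}^t(\mathbf{v})$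 and $\nabla_{0,k}^t(\mathbf{v})\mapsto\nabla_{0,k+1}^{t-1}(\mathbf{v})$ are homomorphisms from $(\nabla_{0,k}^t(\mathcal{V}),\odot_{0,k}^t)$ to $(\nabla_{0,k+1}^t(\mathcal{V}),\odot_{0,k+1}^t)$ and to $(\nabla_{0,k+1}^{t-1}(\mathcal{V}),\odot_{0,k+1}^{t-1})$. *)

(* Defs.v *)
From HB Require Import structures.
From mathcomp Require Import all_boot all_order all_algebra all_fingroup.
From mathcomp Require Import boolp classical_sets functions.

Set Implicit Arguments.
Unset Strict Implicit.
Unset Printing Implicit Defensive.

Import Order.TTheory GRing.Theory Num.Theory.
Local Open Scope classical_set_scope.
Local Open Scope ring_scope.

(* The full product of the groups gT t over all times t. *)
Definition seqs (gT : int -> finGroupType) : Type := forall t : int, gT t.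

Section SeqsGroup.
Variable gT : int -> finGroupType.
Implicit Types a b c : seqs gT.

Definition seq_one : seqs gT := fun t => 1%g.
Definition seq_inv a : seqs gT := fun t => (a t)^-1%g.
Definition seq_mul a b : seqs gT := fun t => (a t * b t)%g.

Lemma seq_mulA : associative seq_mul.
Proof. by move=> a b c; apply: functional_extensionality_dep => t; apply: mulgA. Qed.
Lemma seq_mul1 : left_id seq_one seq_mul.
Proof. by move=> a; apply: functional_extensionality_dep => t; apply: mul1g. Qed.
Lemma seq_mulr1 : right_id seq_one seq_mul.
Proof. by move=> a; apply: functional_extensionality_dep => t; apply: mulg1. Qed.
Lemma seq_mulV : left_inverse seq_one seq_inv seq_mul.
Proof. by move=> a; apply: functional_extensionality_dep => t; apply: mulVg. Qed.
Lemma seq_mulrV : right_inverse seq_one seq_inv seq_mul.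
Proof. by move=> a; apply: functional_extensionality_dep => t; apply: mulgV. Qed.

HB.instance Definition _ := Choice.copy (seqs gT) (forall t : int, gT t).
HB.instance Definition _ := isGroup.Build (seqs gT)
  seq_mulA seq_mul1 seq_mulr1 seq_mulV seq_mulrV.

End SeqsGroup.

Section GroupSystem.
Variable gT : int -> finGroupType.
Implicit Types (A S T : set (seqs gT)) (t m n : int).

Definition chi t (a : seqs gT) : gT t := a t.

Definition group_system A : Prop :=
  group_closed (mem A) /\
  forall t (x : gT t), exists2 a, A a & chi t a = x.

Definition controllable (l : nat) A : Prop :=
  forall t a b, A a -> A b ->
    exists c, [/\ A c, forall s, s < t -> c s = a s
                & forall s, t + l%:Z <= s -> c s = b s].

Definition complete A : Prop :=
  forall a : seqs gT,
    (forall m n, exists2 b, A b & forall s, m <= s <= n -> a s = b s) -> A a.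

(* Sequences of A supported in [m, n]. *)
Definition Aint A m n : set (seqs gT) :=
  [set a | A a /\ forall s, ~~ (m <= s <= n) -> a s = 1%g].

Definition Xsub A t : set (seqs gT) :=
  [set a | A a /\ forall s, s < t -> a s = 1%g].

Definition Ysub A t : set (seqs gT) :=
  [set a | A a /\ forall s, t < s -> a s = 1%g].

Definition set_mul S T : set (seqs gT) :=
  [set c | exists2 a, S a & exists2 b, T b & c = (a * b)%g].

Definition set_lcoset (a : seqs gT) T : set (seqs gT) :=
  [set c | exists2 b, T b & c = (a * b)%g].

(* The set of (left) cosets of T in S. *)
Definition cosets S T : set (set (seqs gT)) :=
  [set C | exists2 a, S a & C = set_lcoset a T].

(* The quotient Lambda^[t, t + k]; for k = 0 its denominator is X^(t+1). *)
Definition Lambda A t (k : nat) : set (set (seqs gT)) :=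
  cosets (set_mul (Xsub A (t + 1)) (Xsub A t `&` Ysub A (t + k%:Z)))
         (set_mul (Xsub A (t + 1)) (Xsub A t `&` Ysub A (t + k%:Z - 1))).

Definition transversal_of (P : set (set (seqs gT))) T : Prop :=
  T `<=` \bigcup_(C in P) C /\
  forall C, P C -> exists! g, T g /\ C g.

Record basis A (l : nat) : Type := Basis {
  gens : int -> 'I_l.+1 -> set (seqs gT);
  gens_transversal : forall t (k : 'I_l.+1),
    transversal_of (Lambda A t k) (gens t k);
  gens_sub : forall t (k : 'I_l.+1), gens t k `<=` Aint A t (t + (k : nat)%:Z);
  gens_1 : forall t (k : 'I_l.+1), gens t k 1%g
}.

End GroupSystem.

Definition dblprod (l : nat) (W : int -> 'I_l.+1 -> Type) : Type :=
  forall (s : int) (m : 'I_l.+1), W s m.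

Section GeneratorGroup.
Variables (gT : int -> finGroupType) (A : set (seqs gT)) (l : nat).
Variable B : basis A l.

(* Index (t, k) stands for the generator g^[t, t + k]. *)
Definition Rset : Type := dblprod (fun t k => gens B t k).

Definition Rtriv : Rset := fun t k => SigSub (mem_set (gens_1 B t k)).

Definition alpha (r : Rset) : seqs gT := fun t =>
  (\prod_(j < l.+1) \prod_(k < l.+1 | (j <= k)%N)
     chi t (val (r (t - (j : nat)%:Z) k)))%g.

(* Inverse of a bijection, extended by Rtriv outside of its range. *)
Definition alphaV : seqs gT -> Rset := 'pinv_(fun=> Rtriv) [set: Rset] alpha.

Definition star (r1 r2 : Rset) : Rset := alphaV (alpha r1 * alpha r2)%g.

Variables (G : int -> 'I_l.+1 -> Type) (lab : forall t k, gens B t k -> G t k).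

Definition beta (r : Rset) : dblprod G := fun t k => lab (r t k).

Definition betaV : dblprod G -> Rset := 'pinv_(fun=> Rtriv) [set: Rset] beta.

Definition circ (u1 u2 : dblprod G) : dblprod G :=
  beta (star (betaV u1) (betaV u2)).

End GeneratorGroup.

Definition is_group (T : Type) (op : T -> T -> T) : Prop :=
  associative op /\
  exists e : T, [/\ left_id e op, right_id e op
                  & forall x, exists y, op y x = e /\ op x y = e].

Section Triangles.
Variable l : nat.
Implicit Types (k : 'I_l.+1) (t : int).

Definition tri k t : set ('I_l.+1 * int) :=
  [set p : 'I_l.+1 * int | exists j : nat,
     [/\ (j <= l - k)%N, (k + j <= p.1)%N & p.2 = t - j%:Z]].

Lemma tri_sub k k' t : k' = k.+1 :> nat -> tri k' t `<=` tri k t.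
Proof.
move=> kk' [m s] [j /= [jl jm ->]]; exists j; split=> //=.
- by apply: leq_trans jl _; rewrite kk' leq_sub2l.
- by apply: leq_trans jm; rewrite kk' leq_add2r.
Qed.

Lemma tri_sub_pred k k' t : k' = k.+1 :> nat -> tri k' (t - 1) `<=` tri k t.
Proof.
move=> kk' [m s] [j /= [jl jm ->]]; exists j.+1; split=> /=.
- have kl : (k < l)%N by rewrite -kk' -ltnS ltn_ord.
  by move: jl; rewrite kk' subnS -ltnS prednK // subn_gt0.
- by apply: leq_trans jm; rewrite kk' addnS.
- by rewrite -addrA -opprD.
Qed.

Section Nabla.
Variable W : int -> 'I_l.+1 -> Type.

Definition restr (D : set ('I_l.+1 * int)) : Type :=
  forall p : D, W (val p).2 (val p).1.

Definition restrict_to (D : set ('I_l.+1 * int)) (w : dblprod W) : restr D :=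
  fun p => w (val p).2 (val p).1.

(* nabla_{0,k}^t(W): the set of restrictions of elements of the double product,
   so that it is empty as soon as one factor is. *)
Definition Nabla k t : Type := range (@restrict_to (tri k t)).

Definition nabla k t (w : dblprod W) : Nabla k t :=
  SigSub (mem_set (imageT (@restrict_to (tri k t)) w)).

Definition restr_sub (D D' : set ('I_l.+1 * int)) (sub : D' `<=` D)
    (x : restr D) : restr D' :=
  fun p => x (SigSub (mem_set (sub _ (set_mem (valP p))))).

Lemma restr_sub_range k k' t t' (sub : tri k' t' `<=` tri k t) (x : Nabla k t) :
  range (@restrict_to (tri k' t')) (restr_sub sub (val x)).
Proof. by have /set_mem [w _ <-] := valP x; exists w. Qed.

Definition proj k k' t t' (sub : tri k' t' `<=` tri k t) (x : Nabla k t) :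
    Nabla k' t' :=
  SigSub (mem_set (restr_sub_range sub x)).

(* proj is the projection nabla_{0,k}^t(w) |-> nabla_{0,k'}^t'(w). *)
Lemma proj_nabla k k' t t' (sub : tri k' t' `<=` tri k t) (w : dblprod W) :
  proj sub (nabla k t w) = nabla k' t' w.
Proof. exact: val_inj. Qed.

(* (l+1)-depth elementary systems with elementary set dblprod W. *)
Record elementary_system : Type := ElementarySystem {
  elist : forall k t, Nabla k t -> Nabla k t -> Nabla k t;
  elist_group : forall k t, is_group (@elist k t);
  elist_homo : forall k k' t (kk' : k' = k.+1 :> nat),
    {morph proj (tri_sub (t := t) kk') :
       x y / elist x y >-> elist x y};
  elist_homo_pred : forall k k' t (kk' : k' = k.+1 :> nat),
    {morph proj (tri_sub_pred (t := t) kk') :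
       x y / elist x y >-> elist x y}
}.

(* op k t is the law induced by c on restrictions to the triangle tri k t; that
   such an op exists means that the induced laws are well defined. *)
Definition upper_elementary (c : dblprod W -> dblprod W -> dblprod W)
    (op : forall k t, Nabla k t -> Nabla k t -> Nabla k t) : Prop :=
  forall k t (u v : dblprod W),
    op k t (nabla k t u) (nabla k t v) = nabla k t (c u v).

End Nabla.
End Triangles.

(* Main.v *)
(* Put N(t,k) = X^{t+1} Y^{t+k-1}, a normal subgroup of A. Modulo N(t,k), every
   generator whose span does not cover [t, t+k] dies, so alpha(r) is congruent to
   the finite product of the generators indexed by the triangle of (t,k).
   Conversely the coset of alpha(r) modulo N(t,k) determines these generators, by
   downward induction on k: N(t,k) is contained in N(t,k+1) and in N(t-1,k+1),
   whose triangles together miss only the leftmost factor g^[t,t+k], and this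
   factor is recovered from Lambda^[t,t+k]. Thus nabla_{0,k}^t(U) is in bijection
   with A / N(t,k), and the upper elementary law is the law of this quotient.
   The same induction, started from N(t,l+1) = A (controllability), builds a
   preimage under alpha of any a in A, since N(t,0) only contains sequences that
   are trivial at time t. *)
Require Import Defs.
From mathcomp Require Import all_boot all_order all_algebra all_fingroup.
From mathcomp Require Import boolp classical_sets functions.
From mathcomp Require Import zify.

Set Implicit Arguments.
Unset Strict Implicit.
Unset Printing Implicit Defensive.

Import Order.TTheory GRing.Theory Num.Theory.
Local Open Scope classical_set_scope.
Local Open Scope ring_scope.

(** * Normal subgroups of [A] and congruence modulo the product [X^{t+1} Y^{t+k-1}] *)

Section Congruence.
Variables (gT : int -> finGroupType) (A : set (seqs gT)).
Hypothesis A_group : group_closed (mem A).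
Implicit Types (a b c : seqs gT) (N S T : set (seqs gT)).

Lemma seq_ext a b : (forall s, a s = b s) -> a = b.
Proof. exact: functional_extensionality_dep. Qed.

Lemma seqs_mulE a b s : (a * b)%g s = (a s * b s)%g. Proof. by []. Qed.
Lemma seqs_invE a s : (a^-1)%g s = (a s)^-1%g. Proof. by []. Qed.

Lemma seqs_prodE I (r : seq I) (P : pred I) (F : I -> seqs gT) s :
  (\prod_(i <- r | P i) F i)%g s = (\prod_(i <- r | P i) F i s)%g.
Proof. exact: (big_morph (fun a : seqs gT => a s)). Qed.

Lemma mem_one : A 1%g.
Proof. by case: A_group => /set_mem. Qed.

Lemma mem_inv a : A a -> A (a^-1)%g.
Proof. by move=> /mem_set Aa; apply: set_mem; apply: (group_closedV A_group). Qed.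

Lemma mem_mul a b : A a -> A b -> A (a * b)%g.
Proof.
move=> /mem_set Aa /mem_set Ab.
by apply: set_mem; apply: (group_closedM A_group).
Qed.

Lemma mem_conj a b : A a -> A b -> A (a ^ b)%g.
Proof. by move=> *; rewrite conjgE; do !apply: mem_mul => //; apply: mem_inv. Qed.

Definition normal_in N : Prop :=
  [/\ N `<=` A, N 1%g, (forall a b, N a -> N b -> N (a * b)%g),
      (forall a, N a -> N (a^-1)%g) & (forall a b, N a -> A b -> N (a ^ b)%g)].

Lemma normal_set_mul S T : normal_in S -> normal_in T -> normal_in (set_mul S T).
Proof.
move=> [SA S1 SM SV SJ] [TA T1 TM TV TJ]; split.
- by move=> _ [a /SA Aa [b /TA Ab ->]]; apply: mem_mul.
- by exists 1%g => //; exists 1%g => //; rewrite mulg1.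
- move=> _ _ [a Sa [b Tb ->]] [c Sc [d Td ->]].
  exists (a * c ^ b^-1)%g; first by apply/SM/SJ => //; apply/TA/TV.
  by exists (b * d)%g; [exact: TM | rewrite conjgE invgK !mulgA mulgVK].
- move=> _ [a Sa [b Tb ->]]; exists (a^-1 ^ b)%g; first exact/SJ/TA/Tb/SV.
  by exists (b^-1)%g; [exact: TV | rewrite invgM conjgE !mulgA mulgK].
- move=> _ c [a Sa [b Tb ->]] Ac; exists (a ^ c)%g; first exact: SJ.
  by exists (b ^ c)%g; [exact: TJ | rewrite conjMg].
Qed.

Lemma Xsub_normal t : normal_in (Xsub A t).
Proof.
split.
- by move=> a [].
- by split; first exact: mem_one.
- move=> a b [Aa a1] [Ab b1]; split; first exact: mem_mul.
  by move=> s st; rewrite seqs_mulE a1 // b1 // mulg1.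
- move=> a [Aa a1]; split; first exact: mem_inv.
  by move=> s st; rewrite seqs_invE a1 // invg1.
- move=> a b [Aa a1] Ab; split; first exact: mem_conj.
  by move=> s st; rewrite conjgE !seqs_mulE a1 // mul1g seqs_invE mulVg.
Qed.

Lemma Ysub_normal t : normal_in (Ysub A t).
Proof.
split.
- by move=> a [].
- by split; first exact: mem_one.
- move=> a b [Aa a1] [Ab b1]; split; first exact: mem_mul.
  by move=> s st; rewrite seqs_mulE a1 // b1 // mulg1.
- move=> a [Aa a1]; split; first exact: mem_inv.
  by move=> s st; rewrite seqs_invE a1 // invg1.
- move=> a b [Aa a1] Ab; split; first exact: mem_conj.
  by move=> s st; rewrite conjgE !seqs_mulE a1 // mul1g seqs_invE mulVg.
Qed.

Definition congr_mod N a b : Prop := [/\ A a, A b & N (a * b^-1)%g].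

Section NormalSubgroup.
Variable N : set (seqs gT).
Hypothesis N_normal : normal_in N.

Lemma congr_refl a : A a -> congr_mod N a a.
Proof. by case: N_normal => _ N1 _ _ _ Aa; split; rewrite // mulgV. Qed.

Lemma congr_sym a b : congr_mod N a b -> congr_mod N b a.
Proof.
case: N_normal => _ _ _ NV _ [Aa Ab /NV]; rewrite invgM invgK.
by split.
Qed.

Lemma congr_trans b a c : congr_mod N a b -> congr_mod N b c -> congr_mod N a c.
Proof.
case: N_normal => _ _ NM _ _ [Aa Ab Nab] [_ Ac Nbc]; split=> //.
by have := NM _ _ Nab Nbc; rewrite mulgA mulgVK.
Qed.

Lemma congr_mul a b c d :
  congr_mod N a b -> congr_mod N c d -> congr_mod N (a * c)%g (b * d)%g.
Proof.
case: N_normal => _ _ NM _ NJ [Aa Ab Nab] [Ac Ad Ncd].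
split; try exact: mem_mul.
have := NM _ _ Nab (NJ _ _ Ncd (mem_inv Ab)).
by rewrite conjgE invgK invgM !mulgA mulgVK.
Qed.

(** A filtered-out factor counts as [1], so an index kept by only one of [P] and [Q] must carry a
    factor that is trivial modulo [N]. *)
Lemma congr_prod I (s : seq I) (P Q : pred I) (F H : I -> seqs gT) :
    (forall i, congr_mod N (if P i then F i else 1%g) (if Q i then H i else 1%g)) ->
  congr_mod N (\prod_(i <- s | P i) F i)%g (\prod_(i <- s | Q i) H i)%g.
Proof.
move=> FH; rewrite big_mkcond (big_mkcond Q); apply: big_ind2 => [|a b c d|i _].
- exact/congr_refl/mem_one.
- exact: congr_mul.
- exact: FH.
Qed.

Lemma congr_one a : N a -> congr_mod N a 1%g.
Proof.
by case: N_normal => NA _ _ _ _ Na; split; [exact: NA | exact: mem_one |];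
  rewrite invg1 mulg1.
Qed.

(** The hypothesis puts [a * b^-1] in [N]. Conjugating by [a] and inverting gives the form
    [a^-1 * b] that compares left cosets, as in [Lambda]. *)
Lemma congr_cancel a b c :
  A c -> A a -> A b -> congr_mod N (a * c)%g (b * c)%g -> N (a^-1 * b)%g.
Proof.
case: N_normal => NA _ _ NV NJ Ac Aa Ab [_ _].
rewrite invgM !mulgA mulgK => Nab; have := NV _ (NJ _ _ Nab Aa).
by rewrite conjgE !invgM !invgK !mulgA mulgVK.
Qed.

End NormalSubgroup.

Lemma congr_sub N N' a b : N `<=` N' -> congr_mod N a b -> congr_mod N' a b.
Proof. by move=> NN' [Aa Ab /NN']; split. Qed.

(** This is the subgroup [N(t, k)] of the overview. Here [k] is a plain natural number, so that the
    starting level [l.+1] is allowed. *)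
Definition gap (t : int) (k : nat) : set (seqs gT) :=
  set_mul (Xsub A (t + 1)) (Ysub A (t + k%:Z - 1)).

Lemma gap_normal t k : normal_in (gap t k).
Proof. exact: normal_set_mul (Xsub_normal _) (Ysub_normal _). Qed.

Lemma Xsub_sub t t' : t <= t' -> Xsub A t' `<=` Xsub A t.
Proof. by move=> tt' a [Aa a1]; split=> // s st; apply/a1/(lt_le_trans st). Qed.

Lemma Ysub_sub t t' : t <= t' -> Ysub A t `<=` Ysub A t'.
Proof. by move=> tt' a [Aa a1]; split=> // s st; apply/a1/(le_lt_trans tt'). Qed.

Lemma gap_sub t k t' k' : t' <= t -> t + k%:Z <= t' + k'%:Z -> gap t k `<=` gap t' k'.
Proof.
move=> tt' kk' _ [a Xa [b Yb ->]]; exists a.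
  by apply: Xsub_sub Xa; lia.
by exists b => //; apply: Ysub_sub Yb; lia.
Qed.

Lemma Xsub_gap t k s : t < s -> Xsub A s `<=` gap t k.
Proof.
move=> ts a Xa; exists a; first by apply: Xsub_sub Xa; lia.
by exists 1%g; [case: (Ysub_normal (t + k%:Z - 1)) | rewrite mulg1].
Qed.

Lemma Ysub_gap t k s : s < t + k%:Z -> Ysub A s `<=` gap t k.
Proof.
move=> st b Yb; exists 1%g; first by case: (Xsub_normal (t + 1)).
by exists b; [apply: Ysub_sub Yb; lia | rewrite mul1g].
Qed.

(** For [k = 0] the factors lie in [X^{t+1}] and [Y^{t-1}], both trivial at time [t]. This turns
    congruences into equalities of components. *)
Lemma gap0_at t a : gap t 0 a -> a t = 1%g.
Proof.
move=> [x [_ x1] [y [_ y1] ->]]; rewrite seqs_mulE x1 ?y1 ?mulg1 //; lia.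
Qed.

(* If the element is [x y = x' y'], then [x^-1 x' = y y'^-1] is the required
   element of [X^t \cap Y^(t + k)]. *)
Lemma gap_inter t k a : gap t k.+1 a -> gap (t - 1) k.+1 a ->
  exists2 z, (Xsub A t `&` Ysub A (t + k%:Z)) z & congr_mod (gap t k) a z.
Proof.
move=> [x Xx [y Yy axy]] [x' Xx' [y' Yy' ax'y']].
have [XA _ XM XV _] := Xsub_normal t; have [YA _ YM YV _] := Ysub_normal (t + k%:Z).
have {}Xx' : Xsub A t x' by apply: Xsub_sub Xx'; lia.
have Yy2 : Ysub A (t + k%:Z) y by apply: Ysub_sub Yy; lia.
have Yy'2 : Ysub A (t + k%:Z) y' by apply: Ysub_sub Yy'; lia.
have Xx2 : Xsub A t x by apply: Xsub_sub Xx; lia.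
have xx' : (x^-1 * x' = y * y'^-1)%g.
  by apply: (mulgI x); rewrite mulgA mulgV mul1g mulgA -axy ax'y' mulgK.
have Xz : Xsub A t (x^-1 * x')%g by apply: XM => //; apply: XV.
have Yz : Ysub A (t + k%:Z) (x^-1 * x')%g by rewrite xx'; apply: YM => //; apply: YV.
exists (x^-1 * x')%g => //.
have Az := XA _ Xz.
(* Modulo [gap t k] the outer factors disappear: [x] lies in [X^{t+1}], and [y'], coming from time
   [t - 1], lies in [Y^{t+k-1}]. *)
have -> : a = (x * (x^-1 * x') * y')%g by rewrite mulgA mulgV mul1g -ax'y'.
set z := (x^-1 * x')%g in Xz Yz Az *.
suff : congr_mod (gap t k) (x * z * y')%g (1 * z * 1)%g by rewrite mul1g mulg1.
have Ng := gap_normal t k.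
apply: congr_mul => //; last by apply/congr_one/Ysub_gap/Yy' => //; lia.
apply: congr_mul => //; last exact: congr_refl.
by apply/congr_one/Xsub_gap/Xx => //; lia.
Qed.

(** Controllability joins the identity before [t + 1] to [a] from [t + 1 + l] on. The resulting [c]
    is in [X^{t+1}] and [c^-1 * a] is in [Y^{t+l}]. *)
Lemma gap_full l t a : controllable l A -> A a -> gap t l.+1 a.
Proof.
move=> Actrl Aa; have [c [Ac c1 ca]] := Actrl (t + 1) _ _ mem_one Aa.
have cX : Xsub A (t + 1) c by split.
exists c => //; exists (c^-1 * a)%g; last by rewrite mulgA mulgV mul1g.
split=> [|s ts]; first exact/mem_mul/Aa/mem_inv.
rewrite seqs_mulE seqs_invE ca ?mulVg //; lia.
Qed.

End Congruence.

(** * Splitting finite noncommutative products *)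

(** [P] holds on an initial segment of indices, so no factors have to be interchanged. *)
Lemma prod_split (gT : groupType) (n : nat) (P : pred nat) (F : nat -> gT) :
    (forall i j, (i <= j)%N -> P j -> P i) ->
  (\prod_(j < n) F j)%g =
  ((\prod_(j < n) (if P j then F j else 1)) *
   (\prod_(j < n) (if P j then 1 else F j)))%g.
Proof.
move=> P_anti; elim: n => [|n IHn]; first by rewrite !big_ord0 mulg1.
rewrite !big_ord_recr /= IHn; case: ifP => Pn; last by rewrite mulg1 mulgA.
rewrite [X in (_ * X * _)%g]big1 ?[X in (_ * _ * (X * _))%g]big1 ?mulg1 //.
by move=> j _; rewrite (P_anti j n) // ltnW.
by move=> j _; rewrite (P_anti j n) // ltnW.
Qed.

Lemma prod_only1 (gT : groupType) (n : nat) (i : 'I_n) (F : 'I_n -> gT) :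
  (forall j, j != i -> F j = 1%g) -> (\prod_(j < n) F j)%g = F i.
Proof.
move=> F1; rewrite (eq_bigr (fun j => if j == i then F j else 1%g)).
  by rewrite -big_mkcond big_pred1_eq.
by move=> j _; case: eqP => // /eqP /F1.
Qed.

Lemma prod_geq_recl (gT : groupType) (n : nat) (i : 'I_n) (F : 'I_n -> gT) :
  (\prod_(m < n | (i <= m)%N) F m = F i * \prod_(m < n | (i < m)%N) F m)%g.
Proof.
elim: n => [|n IHn] in i F *; first by case: i.
rewrite [LHS]big_mkcond [in RHS]big_mkcond !big_ord_recl /=.
case: (unliftP ord0 i) => [i'|] -> /=.
  by rewrite !mul1g -!big_mkcond; apply: (IHn i' (fun m => F (lift ord0 m))).
by rewrite mul1g; congr mul; apply: eq_bigr.
Qed.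

(** * The map [alpha] and its finite truncations *)

Section Basis.
Variables (gT : int -> finGroupType) (A : set (seqs gT)) (l : nat).
Hypotheses (A_group : group_closed (mem A)) (B : basis A l).
Implicit Types (r : Rset B) (s t : int) (Q : nat -> nat -> bool).

Definition gen r s m : seqs gT := val (r s m).

Lemma gen_gens r s m : gens B s m (gen r s m).
Proof. exact: set_mem (valP (r s m)). Qed.

Lemma gen_inj r r' s m : gen r s m = gen r' s m -> r s m = r' s m.
Proof. exact: val_inj. Qed.

Lemma gens_X s m g : gens B s m g -> Xsub A s g.
Proof.
by case/gens_sub => Ag g1; split=> // u us; apply: g1; lia.
Qed.

Lemma gens_Y s m g : gens B s m g -> Ysub A (s + (m : nat)%:Z) g.
Proof.
by case/gens_sub => Ag g1; split=> // u us; apply: g1; lia.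
Qed.

Lemma gen_mem r s m : A (gen r s m).
Proof. by case: (gens_X (gen_gens r s m)). Qed.

Definition tri_prod Q t r : seqs gT :=
  (\prod_(j < l.+1) \prod_(m < l.+1 | Q j m) gen r (t - (j : nat)%:Z) m)%g.

(* Relative to a time t, index (j, m) stands for the generator g^[t - j, t - j + m]. *)
Definition triangle (k : nat) : nat -> nat -> bool := fun j m => (k + j <= m)%N.

Lemma tri_prod_mem Q t r : A (tri_prod Q t r).
Proof.
by do 2!(apply: big_ind => *; [exact: mem_one | exact: mem_mul |]);
  exact: gen_mem.
Qed.

Lemma tri_prod_eq Q Q' t r r' :
    (forall j m, (j <= l)%N -> Q j m = Q' j m) ->
    (forall j (m : 'I_l.+1), (j <= l)%N -> Q j m ->
      gen r (t - j%:Z) m = gen r' (t - j%:Z) m) ->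
  tri_prod Q t r = tri_prod Q' t r'.
Proof.
move=> QQ' rr'; apply: eq_bigr => j _; have jl : (j <= l)%N by rewrite -ltnS.
by apply: eq_big => m; [exact: QQ' | exact: rr'].
Qed.

(** The base time [s] of the products is independent of [t]; triangles based at [t] are thus also
    compared modulo the subgroup at [t - 1]. *)
Lemma tri_prod_congr t k Q Q' s r :
    (forall j (m : 'I_l.+1), Q j m != Q' j m -> gap A t k (gen r (s - j%:Z) m)) ->
  congr_mod A (gap A t k) (tri_prod Q s r) (tri_prod Q' s r).
Proof.
move=> QQ'; have Ng := gap_normal A_group t k.
apply: congr_prod => // j; apply: congr_prod => // m.
have := QQ' j m; case: (Q j m) (Q' j m) => -[] => [_|/(_ isT) gg|/(_ isT) gg|_].
- exact/congr_refl/gen_mem.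
- exact: congr_one.
- by apply: congr_sym => //; apply: congr_one.
- by apply: congr_refl => //; apply: mem_one.
Qed.

(** Masking makes partial infinite products again values of [alpha]. *)
Definition mask r (p : pred int) : Rset B :=
  fun s m => if p s then r s m else Rtriv B s m.

Lemma gen_mask r p s m : gen (mask r p) s m = if p s then gen r s m else 1%g.
Proof. by rewrite /gen /mask; case: ifP. Qed.

Lemma mask_mask r p q : mask (mask r p) q = mask r (fun s => p s && q s).
Proof.
apply: functional_extensionality_dep => s.
apply: functional_extensionality_dep => m.
by rewrite /mask; case: (p s); case: (q s).
Qed.

Lemma alphaE r t : alpha r t =
  (\prod_(j < l.+1) \prod_(m < l.+1 | (j <= m)%N) gen r (t - (j : nat)%:Z)%R m t)%g.
Proof. by []. Qed.

Lemma alpha_tri_prod r t : alpha r t = tri_prod (triangle 0) t r t.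
Proof. by rewrite /tri_prod seqs_prodE; apply: eq_bigr => j _; rewrite seqs_prodE. Qed.

Lemma alpha_mask_one r p t :
  (forall s, t - l%:Z <= s <= t -> ~~ p s) -> alpha (mask r p) t = 1%g.
Proof.
move=> pt; rewrite alphaE big1 // => j _; rewrite big1 // => m _.
rewrite gen_mask (negbTE (pt _ _)) //; have := ltn_ord j; lia.
Qed.

(** At each time the factors are ordered by decreasing start [s - j], so those starting after [t]
    form the left part of the product. *)
Lemma alpha_split r t : alpha r =
  (alpha (mask r (fun s => t < s)) * alpha (mask r (fun s => s <= t)))%g.
Proof.
apply: seq_ext => s; rewrite seqs_mulE !alphaE.
pose F (j : nat) := (\prod_(m < l.+1 | (j <= m)%N) gen r (s - j%:Z)%R m s)%g.
rewrite (@prod_split _ _ (fun j => t < s - j%:Z) F); last by move=> i j ij; lia.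
congr mul; apply: eq_bigr => j _.
  by case: ifP => tsj; [apply: eq_bigr | rewrite big1] => // m _;
    rewrite gen_mask tsj.
by case: ltP => tsj; [rewrite big1 | apply: eq_bigr] => // m _;
  rewrite gen_mask leNgt ?tsj // ltNge tsj.
Qed.

Definition layer r s : seqs gT := (\prod_(m < l.+1) gen r s m)%g.

Lemma alpha_layer r t : alpha (mask r (pred1 t)) = layer r t.
Proof.
apply: seq_ext => s; rewrite alphaE /layer seqs_prodE.
have [/andP[ts st]|sout] := boolP (t <= s <= t + l%:Z); last first.
  rewrite !big1 //.
    move=> m _; have [_ ->] := gens_sub (gen_gens r t m); rewrite //.
    by have := ltn_ord m; lia.
  move=> j _; rewrite big1 // => m _; rewrite gen_mask /=; case: eqP => // e.
  by have := ltn_ord j; lia.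
have jl : (`|(s - t)%R| < l.+1)%N by lia.
(* At time [s] only [j = s - t] meets the start [t]. The factors with [m < j] omitted by [alpha]
   have ended before [s]. *)
rewrite (@prod_only1 _ _ (Ordinal jl)) /=; last first.
  move=> j /eqP j_neq; rewrite big1 // => m _; rewrite gen_mask /=.
  by case: eqP => // e; case: j_neq; apply: val_inj => /=; lia.
rewrite big_mkcond; apply: eq_bigr => m _; rewrite gen_mask /=.
have -> : s - `|(s - t)%R|%N%:Z = t by lia.
rewrite eqxx; case: leqP => // ml.
by have [_ ->] := gens_sub (gen_gens r t m); rewrite //; lia.
Qed.

Lemma alpha_le_iter r t n : alpha (mask r (fun s => s <= t)) =
  ((\prod_(j < n) layer r (t - (j : nat)%:Z)%R) *
   alpha (mask r (fun s => s <= t - n%:Z)%R))%g.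
Proof.
elim: n => [|n IHn]; first by rewrite big_ord0 mul1g subr0.
rewrite IHn big_ord_recr -mulgA; congr mul.
rewrite (alpha_split _ (t - n%:Z - 1)) !mask_mask -alpha_layer.
by congr (alpha (mask r _) * alpha (mask r _))%g; apply: funext => s /=; lia.
Qed.

Lemma layer_mem r t : A (layer r t).
Proof.
by apply: big_ind => *; [exact: mem_one | exact: mem_mul | exact: gen_mem].
Qed.

Hypothesis A_complete : complete A.

(** By completeness it suffices to match [alpha r] on each finite interval with a finite product of
    layers. *)
Lemma alpha_mem r : A (alpha r).
Proof.
apply: A_complete => u v.
(* After [n] layers the remaining generators start at or before [v - n], hence end before [u]. *)
pose n := `|(v - u)%R|%N.+1 + l.
exists (\prod_(j < n) layer r (v - (j : nat)%:Z)%R)%g.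
  by apply: big_ind => *; [exact: mem_one | exact: mem_mul | exact: layer_mem].
move=> s suv; rewrite (alpha_split r v) (alpha_le_iter _ _ n) !seqs_mulE.
rewrite alpha_mask_one ?mul1g; last by move=> x; lia.
by rewrite alpha_mask_one ?mulg1 // => x; rewrite /n; lia.
Qed.

(** Generators starting after [t] contribute an element of [X^{t+1}], and those starting before
    [t - l] an element of [Y^{t-1}]. In the remaining [l + 1] layers, those outside the triangle end
    before [t + k]. *)
Lemma alpha_congr r t k :
  congr_mod A (gap A t k) (alpha r) (tri_prod (triangle k) t r).
Proof.
have Ng := gap_normal A_group t k.
rewrite (alpha_split r t) (alpha_le_iter _ _ l.+1).
set x := alpha _; set y := alpha _.
have Nx : gap A t k x.
  apply: (@Xsub_gap _ _ A_group _ _ (t + 1)); first by lia.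
  by split=> [|s st]; [exact: alpha_mem | apply: alpha_mask_one => u; lia].
have Ny : gap A t k y.
  apply: (@Ysub_gap _ _ A_group _ _ (t - 1)); first by lia.
  by split=> [|s st]; [exact: alpha_mem | apply: alpha_mask_one => u; lia].
have -> : tri_prod (triangle k) t r = (1 * (tri_prod (triangle k) t r * 1))%g.
  by rewrite mul1g mulg1.
apply: congr_mul => //; first exact: congr_one.
apply: congr_mul => //; last exact: congr_one.
apply: (@tri_prod_congr _ _ (fun _ _ => true)) => j m; rewrite /triangle.
case: leqP => // mkj _; apply: Ysub_gap (gens_Y (gen_gens r _ m)) => //; lia.
Qed.

End Basis.

(** * Generators as coordinates: [alpha] is a bijection onto [A] *)

Section Coordinates.
Variables (gT : int -> finGroupType) (A : set (seqs gT)) (l : nat).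
Hypotheses (A_group : group_closed (mem A)) (B : basis A l).
Implicit Types (r : Rset B) (s t : int) (Q : nat -> nat -> bool).

(** The denominator of [Lambda] has [X^t \cap Y^{t+k-1}] where [gap] has [Y^{t+k-1}]. Since [g], [h]
    and [x] lie in [X^t], so does [y]; hence [g] and [h] represent the same coset. *)
Lemma gens_uniq t k g h :
  gens B t k g -> gens B t k h -> gap A t k (g^-1 * h)%g -> g = h.
Proof.
move=> Bg Bh [x Xx [y Yy gh]].
have [_ X1 _ _ _] := Xsub_normal A_group (t + 1).
have [_ X1t XM XV _] := Xsub_normal A_group t.
have [_ Y1 _ _ _] := Ysub_normal A_group (t + (k : nat)%:Z - 1).
pose D := set_mul (Xsub A (t + 1)) (Xsub A t `&` Ysub A (t + (k : nat)%:Z - 1)).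
have D1 : D 1%g by exists 1%g => //; exists 1%g; [split | rewrite mulg1].
have Dgh : D (g^-1 * h)%g.
  exists x => //; exists y => //; split=> //.
  have -> : y = (x^-1 * (g^-1 * h))%g by rewrite gh mulgA mulVg mul1g.
  apply: (XM); last by apply: (XM); [apply: (XV); exact: gens_X Bg | exact: gens_X Bh].
  by apply: XV; apply: Xsub_sub Xx; lia.
have LC : Lambda A t k (set_lcoset g D).
  exists g => //; exists 1%g => //; exists g; last by rewrite mul1g.
  by split; [exact: gens_X Bg | exact: gens_Y Bg].
have [_ /(_ _ LC) [f [_ f_uniq]]] := gens_transversal B t k.
have <- : f = g.
  by apply: f_uniq; split; [exact: Bg | exists 1%g; [exact: D1 | rewrite mulg1]].
apply: f_uniq; split; first exact: Bh.
by exists (g^-1 * h)%g; [exact: Dgh | rewrite mulgA mulgV mul1g].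
Qed.

Lemma gens_exists t (k : 'I_l.+1) z :
    (Xsub A t `&` Ysub A (t + (k : nat)%:Z)) z ->
  exists2 g, gens B t k g & congr_mod A (gap A t k) z g.
Proof.
move=> [Xz Yz]; have [XA X1 _ _ _] := Xsub_normal A_group (t + 1).
pose D := set_mul (Xsub A (t + 1)) (Xsub A t `&` Ysub A (t + (k : nat)%:Z - 1)).
have LC : Lambda A t k (set_lcoset z D).
  exists z => //; exists 1%g => //; exists z; last by rewrite mul1g.
  by split.
have [_ /(_ _ LC) [g [[Bg [d Dd gzd]] _]]] := gens_transversal B t k.
have Ng := gap_normal A_group t k.
have gap_d : gap A t k d.
  by case: Dd => x Xx [y [_ Yy] ->]; exists x => //; exists y.
exists g => //; rewrite gzd -{1}(mulg1 z); apply: congr_mul => //.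
  by apply: congr_refl => //; case: Xz.
by apply: congr_sym => //; apply: congr_one.
Qed.

(** The triangle without its corner [(0, k)], which stands for the leftmost factor
    [g^[t, t + k]]. *)
Definition subtriangle (k : nat) : nat -> nat -> bool :=
  fun j m => (k + j <= m)%N && ((0 < j) || (k < m))%N.

Lemma tri_prod_recl r t (k : 'I_l.+1) :
  tri_prod (triangle k) t r = (gen r t k * tri_prod (subtriangle k) t r)%g.
Proof.
rewrite /tri_prod /triangle /subtriangle !big_ord_recl mulgA; congr mul.
  rewrite subr0 addn0 prod_geq_recl; congr mul; apply: eq_bigl => m /=.
  by apply/idP/idP; lia.
by apply: eq_bigr => j _; apply: eq_bigl => m /=; rewrite andbT.
Qed.

(** The indices dropped have [m = k + j]: their generators end exactly at [t + k], too early for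
    level [k.+1]. *)
Lemma subtriangle_congr r t k :
  congr_mod A (gap A t k.+1)
    (tri_prod (subtriangle k) t r) (tri_prod (triangle k.+1) t r).
Proof.
apply: tri_prod_congr => // j m; rewrite /subtriangle /triangle => jm.
by apply: Ysub_gap (gens_Y (gen_gens r _ m)) => //; lia.
Qed.

Lemma subtriangle_congr_pred r t k :
  congr_mod A (gap A (t - 1) k.+1)
    (tri_prod (subtriangle k) t r) (tri_prod (triangle k.+1) (t - 1) r).
Proof.
(* Shifting [j] by one turns the triangle of [(t - 1, k.+1)] into the part [0 < j] of the triangle
   of [(t, k)]. The generators left over start at [t], hence are trivial modulo
   [gap A (t - 1) k.+1]. *)
pose Q (j m : nat) := (k + j <= m)%N && (0 < j)%N.
have -> : tri_prod (triangle k.+1) (t - 1) r = tri_prod Q t r.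
  rewrite /tri_prod [RHS]big_ord_recl [X in (X * _)%g]big1 ?mul1g; last first.
    by move=> m; rewrite /Q andbF.
  rewrite [LHS]big_ord_recr /= [X in (_ * X)%g]big1 ?mulg1; last first.
    by move=> m; rewrite /triangle /=; have := ltn_ord m; lia.
  apply: eq_bigr => j _; apply: eq_big => m; rewrite /= /bump leq0n /= add1n.
    by rewrite /Q /triangle; lia.
  by move=> _; congr (gen r _ m); rewrite -addn1; lia.
apply: tri_prod_congr => // j m; rewrite /subtriangle /Q => jm.
by apply: Xsub_gap (gens_X (gen_gens r _ m)) => //; lia.
Qed.

Lemma tri_prod_inj r r' k t (j : nat) (m : 'I_l.+1) :
    congr_mod A (gap A t k) (tri_prod (triangle k) t r) (tri_prod (triangle k) t r') ->
  (k + j <= m)%N -> gen r (t - j%:Z) m = gen r' (t - j%:Z) m.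
Proof.
(* Downward induction on [k], measured by [n]; once [k] exceeds [l] the triangle is empty. *)
have [n kn] : exists n, (l < k + n)%N by exists l.+1; lia.
elim: n => [|n IHn] in k t j m kn *; first by have := ltn_ord m; lia.
move=> tri_rr' kjm; have km : (k < l.+1)%N by have := ltn_ord m; lia.
have Ng t' := gap_normal A_group t' k.+1.
have knS : (l < k.+1 + n)%N by lia.
have tri_prod_sub := @tri_prod_recl _ t (Ordinal km).
have rr'_t i (p : 'I_l.+1) : (k + i < p)%N -> gen r (t - i%:Z) p = gen r' (t - i%:Z) p.
  move=> kip; apply: (IHn k.+1) => //.
  have up (u : Rset B) : congr_mod A (gap A t k.+1) (tri_prod (triangle k) t u)
                          (tri_prod (triangle k.+1) t u).
    apply: tri_prod_congr => // j' m'; rewrite /triangle => jm.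
    by apply: Ysub_gap (gens_Y (gen_gens u _ m')) => //; lia.
  apply: (congr_trans (Ng _)) (up r'); apply: (congr_trans (Ng _)) (congr_sub _ tri_rr').
    by apply: congr_sym => //; apply: up.
  by apply: gap_sub; lia.
have rr'_pred i (p : 'I_l.+1) : (k + i < p)%N ->
    gen r (t - 1 - i%:Z) p = gen r' (t - 1 - i%:Z) p.
  move=> kip; apply: (IHn k.+1) => //.
  have up (u : Rset B) : congr_mod A (gap A (t - 1) k.+1) (tri_prod (triangle k) t u)
                          (tri_prod (triangle k.+1) (t - 1) u).
    apply: (congr_trans (Ng _)) (subtriangle_congr_pred u t k).
    apply: tri_prod_congr => // j' m'; rewrite /triangle /subtriangle => jm.
    by apply: Xsub_gap (gens_X (gen_gens u _ m')) => //; lia.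
  apply: (congr_trans (Ng _)) (up r'); apply: (congr_trans (Ng _)) (congr_sub _ tri_rr').
    by apply: congr_sym => //; apply: up.
  by apply: gap_sub; lia.
have sub_rr' i (p : 'I_l.+1) : subtriangle k i p ->
    gen r (t - i%:Z) p = gen r' (t - i%:Z) p.
  (* An index on the edge [p = k + i] has [0 < i], so it is interior when seen from time [t - 1]. *)
  move=> kip; have [/rr'_t //|pki] := boolP (k + i < p)%N.
  have -> : t - i%:Z = t - 1 - i.-1%:Z by move: kip; rewrite /subtriangle; lia.
  by apply: rr'_pred; move: kip; rewrite /subtriangle; lia.
have [/sub_rr' //|] := boolP (subtriangle k j m).
rewrite /subtriangle => not_sub; have j0 : j = 0%N by lia.
have -> : m = Ordinal km by apply: val_inj => /=; lia.
(* Only the corner is left. The other factors agree already and cancel on the right. *)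
rewrite j0 subr0; apply: (gens_uniq (gen_gens r _ _) (gen_gens r' _ _)).
have Ngk := gap_normal A_group t (Ordinal km).
apply: (congr_cancel Ngk (c := tri_prod (subtriangle k) t r)).
- exact: tri_prod_mem.
- exact: gen_mem.
- exact: gen_mem.
- move: tri_rr'; rewrite !tri_prod_sub.
  suff -> : tri_prod (subtriangle k) t r' = tri_prod (subtriangle k) t r by [].
  by apply: tri_prod_eq => // i p _ kip; rewrite sub_rr'.
Qed.

Hypotheses (A_controllable : controllable l A) (A_complete : complete A).

(** The generators of length index [k] are chosen for all [t] at once, from [k = l] down to [0],
    keeping the congruences of the higher levels. *)
Lemma tri_prod_surj a : A a ->
  exists r, forall t, congr_mod A (gap A t 0) a (tri_prod (triangle 0) t r).
Proof.
move=> Aa; suff Hk n k : (l < k + n)%N ->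
    exists r, forall t i, (k <= i)%N -> (i <= l.+1)%N ->
      congr_mod A (gap A t i) a (tri_prod (triangle i) t r).
  by have [|r Hr] := Hk l.+1 0%N; [lia | exists r => t; apply: Hr].
have full r t i : (l < i <= l.+1)%N ->
    congr_mod A (gap A t i) a (tri_prod (triangle i) t r).
  move=> il; split=> //; first exact: tri_prod_mem.
  have -> : i = l.+1 by lia.
  apply: gap_full => //; apply: mem_mul => //; apply: mem_inv => //.
  exact: tri_prod_mem.
elim: n k => [|n IHn] k kn.
  by exists (Rtriv B) => t i ki il; apply: full; lia.
have [|r Hr] := IHn k.+1; first by lia.
have [kl|lk] := ltnP k l.+1; last first.
  by exists r => t i ki il; apply: full; lia.
have ex_g t : exists g : gens B t (Ordinal kl),
    congr_mod A (gap A t k) a (val g * tri_prod (subtriangle k) t r)%g.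
  set p := tri_prod _ t r.
  have Ap : A p by apply: tri_prod_mem.
  have Ngk := gap_normal A_group t k.
  have Ng t' := gap_normal A_group t' k.+1.
  (* By the levels [k.+1] at [t] and at [t - 1], the quotient [a * p^-1] lies in both larger
     subgroups, which is what [gap_inter] asks for. *)
  have [z Xz az] : exists2 z, (Xsub A t `&` Ysub A (t + k%:Z)) z &
      congr_mod A (gap A t k) (a * p^-1)%g z.
    apply: gap_inter => //.
      have [] // := congr_trans (Ng t) (Hr t k.+1 (leqnn _) kl)
        (congr_sym (Ng t) (subtriangle_congr r t k)).
    have [] // := congr_trans (Ng _) (Hr (t - 1) k.+1 (leqnn _) kl)
        (congr_sym (Ng _) (subtriangle_congr_pred r t k)).
  have [g Bg zg] := @gens_exists t (Ordinal kl) z Xz.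
  exists (SigSub (mem_set Bg)) => /=.
  rewrite -[a](mulgVK p); apply: congr_mul => //; last exact: congr_refl.
  exact: congr_trans az zg.
pose f t := sval (cid (ex_g t)).
have Hf t : congr_mod A (gap A t k) a (val (f t) * tri_prod (subtriangle k) t r)%g.
  exact: svalP (cid (ex_g t)).
(* Only the entries of index [k] change; the cast carries [f s] along the equality [m = Ordinal kl].
   [subtriangle k] and the higher triangles involve only [m > k], so they are unaffected. *)
pose r' : Rset B := fun s m =>
  match pselect (m = Ordinal kl) with
  | left e => ecast x (gens B s x) (esym e) (f s)
  | right _ => r s m
  end.
have r'_k s : gen r' s (Ordinal kl) = val (f s).
  rewrite /gen /r'; case: pselect => // e.
  by rewrite (Prop_irrelevance e erefl).
have r'_neq s (m : 'I_l.+1) : (k < m)%N -> gen r' s m = gen r s m.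
  move=> km; rewrite /gen /r'; case: pselect => // e.
  by have := congr1 val e => /=; lia.
exists r' => t i; rewrite leq_eqVlt => /orP[/eqP <- _|ki il].
  have -> := @tri_prod_recl r' t (Ordinal kl).
  rewrite r'_k (_ : tri_prod _ t r' = tri_prod (subtriangle k) t r) //.
  by apply: tri_prod_eq => // j m _; rewrite /subtriangle /= => jm; apply: r'_neq; lia.
rewrite (_ : tri_prod _ t r' = tri_prod (triangle i) t r); first exact: Hr.
by apply: tri_prod_eq => // j m _; rewrite /triangle => jm; apply: r'_neq; lia.
Qed.

Lemma alpha_surj a : A a -> exists r, alpha r = a.
Proof.
move=> /tri_prod_surj[r Hr]; exists r; apply: seq_ext => t.
have [_ _ /gap0_at] := Hr t; rewrite seqs_mulE seqs_invE -alpha_tri_prod => e.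
by apply: (mulIg (alpha r t)^-1%g); rewrite e mulgV.
Qed.

(** This identifies triangle contents with cosets of [N(t, k)]: one direction is [alpha_congr], the
    other adds [tri_prod_inj]. *)
Lemma alpha_eq_tri r r' (k : nat) t :
  (forall j (m : 'I_l.+1), (k + j <= m)%N -> r (t - j%:Z) m = r' (t - j%:Z) m) <->
  congr_mod A (gap A t k) (alpha r) (alpha r').
Proof.
have Ng := gap_normal A_group t k.
have up (u : Rset B) := alpha_congr A_group A_complete u t k.
split=> [rr'|arr' j m kjm].
  apply: (congr_trans Ng (up r)); apply: congr_sym => //.
  have -> : tri_prod (triangle k) t r = tri_prod (triangle k) t r'; last exact: up.
  by apply: tri_prod_eq => // j m _ kjm; rewrite /gen rr'.
apply/gen_inj/tri_prod_inj/kjm; apply: (congr_trans Ng) (up r').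
by apply: (congr_trans Ng) arr'; apply: congr_sym.
Qed.

Lemma alpha_inj : injective (alpha (B := B)).
Proof.
move=> r r' rr'.
apply: functional_extensionality_dep => t.
apply: functional_extensionality_dep => m.
have := (alpha_eq_tri r r' 0 t).2; rewrite rr' => /(_ _ 0%N m); rewrite subr0.
by apply=> //; apply: congr_refl; [exact: gap_normal | exact: alpha_mem].
Qed.

End Coordinates.

(** * Elementary systems induced by a group law on the double product *)

Section Nabla.
Variables (l : nat) (W : int -> 'I_l.+1 -> Type).
Implicit Types (k : 'I_l.+1) (t : int).

Lemma nabla_eqP k t (u v : dblprod W) : nabla k t u = nabla k t v <->
  forall j (m : 'I_l.+1), (k + j <= m)%N -> u (t - j%:Z) m = v (t - j%:Z) m.
Proof.
split=> [uv j m kjm|uv].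
  have tri_p : tri k t (m, t - j%:Z).
    by exists j; split=> //=; have := ltn_ord m; lia.
  have /= := congr1 (fun x => val x (SigSub (mem_set tri_p))) uv.
  by rewrite /restrict_to /=.
apply: val_inj; apply: functional_extensionality_dep => -[[m s] p].
rewrite /= /restrict_to /=.
by have /set_mem [j [_ /= kjm ->]] := p; apply: uv.
Qed.

Lemma nabla_surj k t (x : Nabla W k t) : exists u, nabla k t u = x.
Proof. by have /set_mem [u _ ux] := valP x; exists u; apply: val_inj. Qed.

(** The remaining fields are propositions, so proof irrelevance identifies them. *)
Lemma elementary_system_eq (E F : elementary_system W) :
  elist E = elist F -> E = F.
Proof.
case: E F => [e1 g1 h1 p1] [e2 g2 h2 p2] /= e12; case: _ / e12 in g2 h2 p2 *.
by congr ElementarySystem; apply: Prop_irrelevance.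
Qed.

Lemma upper_elementary_uniq (c : dblprod W -> dblprod W -> dblprod W)
    (E F : elementary_system W) :
  upper_elementary c (elist E) -> upper_elementary c (elist F) -> E = F.
Proof.
move=> cE cF; apply: elementary_system_eq.
apply: functional_extensionality_dep => k.
apply: functional_extensionality_dep => t.
apply: funext => x; apply: funext => y.
by have [[u <-] [v <-]] := (nabla_surj x, nabla_surj y); rewrite cE cF.
Qed.

(** Compatibility makes the law induced by arbitrary extensions well defined. Group axioms and
    homomorphism conditions then pass through the surjections [nabla k t]. *)
Lemma upper_elementary_system (c : dblprod W -> dblprod W -> dblprod W) :
    is_group c ->
    (forall k t u u' v v', nabla k t u = nabla k t u' ->
       nabla k t v = nabla k t v' -> nabla k t (c u v) = nabla k t (c u' v')) ->
  exists E : elementary_system W, upper_elementary c (elist E).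
Proof.
move=> [cA [e [ce1 c1e cV]]] c_compat.
pose rep k t (x : Nabla W k t) := sval (cid (nabla_surj x)).
have repK k t (x : Nabla W k t) : nabla k t (rep k t x) = x.
  exact: svalP (cid (nabla_surj x)).
pose op k t (x y : Nabla W k t) := nabla k t (c (rep k t x) (rep k t y)).
have opE k t u v : op k t (nabla k t u) (nabla k t v) = nabla k t (c u v).
  by apply: c_compat; rewrite repK.
have op_group k t : is_group (@op k t).
  split=> [x y z|].
    have [[u <-] [v <-] [w <-]] := And3 (nabla_surj x) (nabla_surj y) (nabla_surj z).
    by rewrite !opE cA.
  exists (nabla k t e); split=> x; have [u <-] := nabla_surj x.
  - by rewrite opE ce1.
  - by rewrite opE c1e.
  - by have [v [vu uv]] := cV u; exists (nabla k t v); rewrite !opE vu uv.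
have op_proj k k' t t' (sub : tri k' t' `<=` tri k t) :
    {morph proj (W := W) sub : x y / op k t x y >-> op k' t' x y}.
  move=> x y; have [[u <-] [v <-]] := (nabla_surj x, nabla_surj y).
  by rewrite opE !proj_nabla opE.
exists (@ElementarySystem l W op op_group
  (fun k k' t kk' => op_proj _ _ _ _ _) (fun k k' t kk' => op_proj _ _ _ _ _)).
exact: opE.
Qed.

End Nabla.

(** * The generator group as a copy of [A] *)

Section GeneratorGroup.
Variables (gT : int -> finGroupType) (A : set (seqs gT)) (l : nat).
Hypotheses (A_group : group_closed (mem A)) (A_controllable : controllable l A).
Hypothesis A_complete : complete A.
Variables (B : basis A l) (G : int -> 'I_l.+1 -> Type).
Variable lab : forall (t : int) (k : 'I_l.+1), gens B t k -> G t k.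
Hypothesis lab_bij : forall t k, bijective (@lab t k).

Lemma beta_inj : injective (beta lab).
Proof.
move=> r r' rr'.
apply: functional_extensionality_dep => t.
apply: functional_extensionality_dep => m.
by apply: (bij_inj (lab_bij t m)); rewrite -/(beta lab r t m) rr'.
Qed.

Lemma betaVK : cancel (betaV lab) (beta lab).
Proof.
move=> u; apply: pinvK; rewrite inE.
have lab_surj t m : exists g, lab g = u t m.
  by case: (lab_bij t m) => f _ fK; exists (f (u t m)).
exists (fun t m => sval (cid (lab_surj t m))) => //.
apply: functional_extensionality_dep => t.
apply: functional_extensionality_dep => m.
exact: svalP (cid (lab_surj t m)).
Qed.

Lemma betaK : cancel (beta lab) (betaV lab).
Proof. by move=> r; apply: beta_inj; rewrite betaVK. Qed.

Lemma alphaVK a : A a -> alpha (alphaV B a) = a.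
Proof.
move=> Aa; apply: pinvK; rewrite inE.
by have [r ra] := alpha_surj A_group B A_controllable Aa; exists r.
Qed.

(** The isomorphism from the generator group onto [A]. *)
Definition seq_of (u : dblprod G) : seqs gT := alpha (betaV lab u).

Lemma seq_of_mem u : A (seq_of u).
Proof. exact: alpha_mem. Qed.

Lemma seq_of_inj : injective seq_of.
Proof. by move=> u v /(alpha_inj A_group A_complete) /(can_inj betaVK). Qed.

Lemma seq_of_surj a : A a -> exists u, seq_of u = a.
Proof. by move=> /alphaVK aK; exists (beta lab (alphaV B a)); rewrite /seq_of betaK. Qed.

(** The product stays in [A], the range of [alpha], where [alphaV] is a true inverse. *)
Lemma seq_of_circ u v : seq_of (circ lab u v) = (seq_of u * seq_of v)%g.
Proof.
rewrite /seq_of /circ /star betaK alphaVK //.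
by apply: mem_mul => //; apply: alpha_mem.
Qed.

Lemma circ_group : is_group (circ lab).
Proof.
split=> [u v w|]; first by apply: seq_of_inj; rewrite !seq_of_circ mulgA.
have [e e1] := seq_of_surj (mem_one A_group).
exists e; split=> u.
- by apply: seq_of_inj; rewrite seq_of_circ e1 mul1g.
- by apply: seq_of_inj; rewrite seq_of_circ e1 mulg1.
have [v vu] := seq_of_surj (mem_inv A_group (seq_of_mem u)).
exists v; split; apply: seq_of_inj; rewrite seq_of_circ e1 vu.
  exact: mulVg.
exact: mulgV.
Qed.

(** Labels match exactly when generators do, so the fibres of [nabla k t] are the cosets of
    [N(t, k)]. *)
Lemma nabla_seq_of (k : 'I_l.+1) t u v : nabla k t u = nabla k t v <->
  congr_mod A (gap A t k) (seq_of u) (seq_of v).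
Proof.
split=> [/nabla_eqP uv|/alpha_eq_tri uv].
  apply/alpha_eq_tri => // j m /uv; rewrite -{1}(betaVK u) -{1}(betaVK v).
  exact: bij_inj.
apply/nabla_eqP => j m kjm; rewrite -(betaVK u) -(betaVK v) /beta uv //.
Qed.

End GeneratorGroup.

Theorem theorem73 (gT : int -> finGroupType) (A : set (seqs gT)) (l : nat)
    (l_gt0 : (0 < l)%N) (A_system : group_system A)
    (A_controllable : controllable l A) (A_complete : complete A)
    (B : basis A l) (G : int -> 'I_l.+1 -> Type)
    (lab : forall (t : int) (k : 'I_l.+1), gens B t k -> G t k)
    (lab_bij : forall (t : int) (k : 'I_l.+1), bijective (lab t k)) :
  exists! E : elementary_system G, upper_elementary (circ lab) (elist E).
Proof.
have [A_group _] := A_system.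
have [|k t u u' v v'|E cE] := upper_elementary_system (c := circ lab).
- exact: circ_group.
(* The induced law is well defined because congruence modulo the normal subgroup [N(t, k)] respects
   products. *)
- have nablaE := nabla_seq_of A_group A_complete lab_bij.
  have circE := seq_of_circ A_group A_controllable A_complete lab_bij.
  move=> /nablaE uu' /nablaE vv'; apply/nablaE; rewrite !circE.
  by apply: congr_mul => //; apply: gap_normal.
by exists E; split=> // F; apply: upper_elementary_uniq.
Qed.
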